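(* Let $P$ be a poset, let $down(P):=\{\downarrow x: x\in P\}$ where $\downarrow x=\{y\in P:y\le x\}$, and let $\overline{down(P)}$ be the closure of $down(P)$ in $\mathfrak P(P)$ with the product topology. Let $Tailalg(P)$ be the Boolean subalgebra of $\mathfrak P(P)$ generated by $up(P):=\{\uparrow x:x\in P\}$ (where $\uparrow x=\{y\in P: x\le y\}$), and $Taillat(P)$ the bounded sublattice of $(\mathfrak P(P),\cup,\cap,\emptyset,P)$ generated by $up(P)$. Then $\overline{down(P)}$ is homeomorphic to the Stone space of $Tailalg(P)$, and, with the order of inclusion added, $\overline{down(P)}$ is isomorphic to the Priestley space of $Taillat(P)$.
   Context: $\mathfrak P(P)$ is identified with $2^P$ with the product topology (basis: $O(F,G)=\{X\subseteq P: F\subseteq X, G\cap X=\emptyset\}$, $F,G$ finite). The Stone space of a Boolean algebra is its space of ultrafilters; the Priestley space of a bounded distributive lattice is its set of prime filters with the Priestley topology and inclusion order. *)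

(* Defs.v *)
From HB Require Import structures.
From mathcomp Require Import all_boot all_order.
From mathcomp Require Import all_classical.
From mathcomp Require Import finmap topology.

Set Implicit Arguments.
Unset Strict Implicit.
Unset Printing Implicit Defensive.

Import Order.TTheory.

Local Open Scope order_scope.
Local Open Scope classical_set_scope.

(* The power set of T is topologized by transporting the product topology of
   2^T along the bijection sending a subset to its characteristic function. *)
Definition charfun (T : choiceType) (X : set T) :
  prod_topology (fun _ : T => bool) := fun x => `[< X x >].

Definition powerset_space (T : choiceType) : Type :=
  initial_topology (@charfun T).

HB.instance Definition _ (T : choiceType) :=
  Topological.copy (powerset_space T) (initial_topology (@charfun T)).
HB.instance Definition _ (T : choiceType) :=
  Order.POrder.copy (powerset_space T) (set T).

Definition cylinder (T : choiceType) (F G : set T) : set (powerset_space T) :=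
  [set X | F `<=` X /\ G `&` X = set0].

Lemma charfun_coord_open (T : choiceType) (x : T) (b : bool) :
  open [set X : powerset_space T | `[< X x >] = b].
Proof.
have cont : continuous (fun X : powerset_space T => `[< X x >]).
  move=> X; apply: (@continuous_comp _ _ _
    (@charfun T : powerset_space T -> _) (fun f => f x)).
    exact: initial_continuous.
  exact: (@proj_continuous _ (fun _ : T => bool)).
by move/continuousP: cont => /(_ [set b]); apply; exact: discrete_open.
Qed.

Lemma cylinder_basis (T : choiceType) :
  @basis (powerset_space T)
    [set O | exists F G, [/\ finite_set F, finite_set G & O = cylinder F G]].
Proof.
split=> [_ [F [G [fF fG ->]]]|X N].
  rewrite openE => X [XF XG].
  have /finite_fsetP[A FA] := fF; have /finite_fsetP[B GB] := fG.
  rewrite /interior.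
  have nF : nbhs X (\bigcap_(x in [set` A]) [set Y : powerset_space T | `[< Y x >] = true]).
    apply: filter_bigI => x xA; apply: open_nbhs_nbhs.
    by split; [exact: charfun_coord_open|apply/asboolT/XF; rewrite FA].
  have nG : nbhs X (\bigcap_(x in [set` B]) [set Y : powerset_space T | `[< Y x >] = false]).
    apply: filter_bigI => x xB; apply: open_nbhs_nbhs.
    split; first exact: charfun_coord_open.
    by apply/asboolF => Xx; rewrite -[False]/(set0 x) -XG; split=> //; rewrite GB.
  apply: filterS (filterI nF nG) => Y [YF YG]; split.
    by rewrite FA => x /YF/asboolP.
  by rewrite -subset0 GB => x [/YG /= /asboolP].
pose C := filter_from
  [set FG : set T * set T | [/\ finite_set FG.1, finite_set FG.2 & cylinder FG.1 FG.2 X]]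
  (fun FG => cylinder FG.1 FG.2).
have FC : Filter C.
  apply: filter_from_filter.
    exists (set0, set0); split=> /=; rewrite ?set0I; [exact: finite_set0|exact: finite_set0|].
    by split=> //; rewrite set0I.
  move=> [F G] [F' G'] [/= fF fG [XF XG]] [/= fF' fG' [XF' XG']].
  exists (F `|` F', G `|` G').
    split=> /=; [by rewrite finite_setU|by rewrite finite_setU|split].
      by rewrite subUset.
    by rewrite setIUl XG XG' setU0.
  move=> Y /= [+ +]; rewrite subUset setIUl => -[YF YF'].
  by rewrite setU_eq0 => -[YG YG'].
suff CX : C --> (X : powerset_space T).
  move=> /CX[[F G] /= [fF fG CFG] sub].
  by exists (cylinder F G) => //; split=> //; exists F, G.
have CX' : @charfun T @ C --> @charfun T X.
  have surj x : range (fun f : T -> bool => f x) = setT.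
    by rewrite -subTset => b _; exists (fun=> b).
  apply/cvg_sup => x; apply/cvg_image => // V nV.
  exists ((fun f : T -> bool => f x) @^-1` V); last exact: image_preimage.
  have VX : V `[< X x >] by exact: nbhs_singleton nV.
  have [Xx|Xx] := pselect (X x).
    exists ([set x], set0).
      by split=> //=; split; rewrite ?set0I // => _ ->.
    by move=> Y /= [/(_ x erefl) Yx _]; rewrite /charfun asboolT // -(asboolT Xx).
  exists (set0, [set x]).
    split=> //=; split=> //; rewrite -subset0.
    by move=> _ [-> ].
  move=> Y /= [_ YG]; rewrite /charfun asboolF -?(asboolF Xx) // => Yx.
  by rewrite -[False]/(set0 x) -YG.
move=> W [O [[V oV <-] VX] VW]; apply: filterS VW _.
by apply: CX'; exact: open_nbhs_nbhs.
Qed.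

Definition is_homeomorphism (X Y : topologicalType) (f : X -> Y) : Prop :=
  continuous f /\ exists g : Y -> X, [/\ cancel f g, cancel g f & continuous g].

Definition homeomorphic (X Y : topologicalType) : Prop :=
  exists f : X -> Y, is_homeomorphism f.

Definition order_homeomorphic (dX dY : Order.disp_t)
    (X : POrderedTopological.type dX) (Y : POrderedTopological.type dY) : Prop :=
  exists f : X -> Y, is_homeomorphism f /\ {mono f : x y / x <= y}.

Definition proper_lattice_filter (d : Order.disp_t) (L : tbDistrLatticeType d)
    (F : set L) : Prop :=
  [/\ F \top, ~ F \bot, (forall a b, a <= b -> F a -> F b)
    & forall a b, F a -> F b -> F (Order.meet a b)].

Definition prime_filter (d : Order.disp_t) (L : tbDistrLatticeType d)
    (F : set L) : Prop :=
  proper_lattice_filter F /\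
  forall a b, F (Order.join a b) -> F a \/ F b.

(* Ultrafilters are the maximal proper filters. *)
Definition boolean_ultrafilter (d : Order.disp_t) (B : ctbDistrLatticeType d)
    (U : set B) : Prop :=
  proper_lattice_filter U /\
  forall V : set B, proper_lattice_filter V -> U `<=` V -> V = U.

Section Stone.
Context (d : Order.disp_t) (B : ctbDistrLatticeType d).

Definition stone_space : Type := set_type [set U : set B | boolean_ultrafilter U].

HB.instance Definition _ := Choice.on stone_space.

Definition stone_open (a : B) : set stone_space := [set U | val U a].

Lemma stone_cover : \bigcup_(O in range stone_open) O = setT.
Proof.
rewrite -subTset => U _; exists (stone_open \top); first by exists \top.
by have /set_mem[[]] := valP U.
Qed.

Lemma stone_join (O1 O2 : set stone_space) (U : stone_space) :
  range stone_open O1 -> range stone_open O2 -> O1 U -> O2 U ->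
  exists O, [/\ range stone_open O, O U & O `<=` O1 `&` O2].
Proof.
move=> [a _ <-] [b _ <-] Ua Ub; exists (stone_open (Order.meet a b)); split.
- by exists (Order.meet a b).
- by have /set_mem[[_ _ _ +] _] := valP U; apply.
- move=> V Vab; have /set_mem[[_ _ up _] _] := valP V.
  by split; apply: up Vab; rewrite ?leIl ?leIr.
Qed.

HB.instance Definition _ :=
  isBaseTopological.Build stone_space stone_cover stone_join.

End Stone.

Section Priestley.
Context (d : Order.disp_t) (L : tbDistrLatticeType d).

Definition priestley_space : Type := set_type [set F : set L | prime_filter F].

HB.instance Definition _ := SubChoice.on priestley_space.
HB.instance Definition _ :=
  [SubChoice_isSubPOrder of priestley_space by <: with set_display].

Definition priestley_in (a : L) : set priestley_space := [set F | val F a].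
Definition priestley_out (a : L) : set priestley_space := [set F | ~ val F a].

(* Priestley topology: generated by the sets {F | a \in F} and complements. *)
HB.instance Definition _ := @isSubBaseTopological.Build priestley_space
  (set priestley_space) (range priestley_in `|` range priestley_out) id.

End Priestley.

Definition bounded_sublattice (T : Type) (S : set (set T)) : Prop :=
  [/\ S set0, S setT, setU_closed S & setI_closed S].

Definition boolean_subalgebra (T : Type) (S : set (set T)) : Prop :=
  bounded_sublattice S /\ forall A, S A -> S (~` A).

Section Generated.
Context (T : Type) (G : set (set T)).

Local Notation lat := (smallest (@bounded_sublattice T) G).
Local Notation alg := (smallest (@boolean_subalgebra T) G).

Lemma lat_closed : bounded_sublattice lat.
Proof.
split=> [|| A B SA SB | A B SA SB].
- by move=> S [[]].
- by move=> S [[]].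
- by move=> S HS; case: (HS) => -[_ _ + _] _; apply; [exact: SA|exact: SB].
- by move=> S HS; case: (HS) => -[_ _ _ +] _; apply; [exact: SA|exact: SB].
Qed.

Lemma alg_closed : boolean_subalgebra alg.
Proof.
split; last by move=> A SA S HS; case: (HS) => -[_ +] _; apply; exact: SA.
split=> [|| A B SA SB | A B SA SB].
- by move=> S [[[]]].
- by move=> S [[[]]].
- by move=> S HS; case: (HS) => -[[_ _ + _] _] _; apply; [exact: SA|exact: SB].
- by move=> S HS; case: (HS) => -[[_ _ _ +] _] _; apply; [exact: SA|exact: SB].
Qed.

Definition sublattice_by : Type := set_type lat.
Definition subalgebra_by : Type := set_type alg.

HB.instance Definition _ := SubChoice.on sublattice_by.
HB.instance Definition _ := SubChoice.on subalgebra_by.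

Let latU : {in mem lat &, forall A B, Order.join A B \in mem lat}.
Proof.
move=> A B /set_mem SA /set_mem SB; apply/mem_set.
by have [_ _ + _] := lat_closed; apply.
Qed.

Let latI : {in mem lat &, forall A B, Order.meet A B \in mem lat}.
Proof.
move=> A B /set_mem SA /set_mem SB; apply/mem_set.
by have [_ _ _ +] := lat_closed; apply.
Qed.

Let lat0 : \bot \in mem lat.
Proof. by apply/mem_set; case: lat_closed. Qed.

Let lat1 : \top \in mem lat.
Proof. by apply/mem_set; case: lat_closed. Qed.

HB.instance Definition _ :=
  Order.SubChoice_isTBSubLattice.Build set_display (set T) _ set_display
    sublattice_by latI latU lat0 lat1.

Let lat_meetUl :
  @left_distributive sublattice_by sublattice_by Order.meet Order.join.
Proof. by move=> A B C; apply: val_inj; rewrite /= meetUl. Qed.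

HB.instance Definition _ :=
  Order.Lattice_Meet_isDistrLattice.Build set_display sublattice_by lat_meetUl.

Let algU : {in mem alg &, forall A B, Order.join A B \in mem alg}.
Proof.
move=> A B /set_mem SA /set_mem SB; apply/mem_set.
by have [[_ _ + _] _] := alg_closed; apply.
Qed.

Let algI : {in mem alg &, forall A B, Order.meet A B \in mem alg}.
Proof.
move=> A B /set_mem SA /set_mem SB; apply/mem_set.
by have [[_ _ _ +] _] := alg_closed; apply.
Qed.

Let alg0 : \bot \in mem alg.
Proof. by apply/mem_set; case: alg_closed => -[]. Qed.

Let alg1 : \top \in mem alg.
Proof. by apply/mem_set; case: alg_closed => -[]. Qed.

HB.instance Definition _ :=
  Order.SubChoice_isTBSubLattice.Build set_display (set T) _ set_display
    subalgebra_by algI algU alg0 alg1.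

Let alg_meetUl :
  @left_distributive subalgebra_by subalgebra_by Order.meet Order.join.
Proof. by move=> A B C; apply: val_inj; rewrite /= meetUl. Qed.

HB.instance Definition _ :=
  Order.Lattice_Meet_isDistrLattice.Build set_display subalgebra_by alg_meetUl.

Let algC (A : subalgebra_by) : ~` (val A) \in alg.
Proof.
by apply/mem_set; have [_] := alg_closed; apply; apply/set_mem/(valP A).
Qed.

Definition subalgebra_compl (A : subalgebra_by) : subalgebra_by :=
  @Sub _ _ subalgebra_by (~` (val A)) (algC A).

Let alg_joinxC (A : subalgebra_by) : Order.join A (subalgebra_compl A) = \top.
Proof. by apply: val_inj; rewrite /= [LHS]setUCr. Qed.

Let alg_meetxC (A : subalgebra_by) : Order.meet A (subalgebra_compl A) = \bot.
Proof. by apply: val_inj; rewrite /= [LHS]setICr. Qed.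

HB.instance Definition _ :=
  Order.TBDistrLattice_hasComplement.Build set_display subalgebra_by
    alg_joinxC alg_meetxC.

End Generated.

Section Poset.
Context (d : Order.disp_t) (P : porderType d).

Definition principal_up (x : P) : set P := [set y | x <= y].
Definition principal_down (x : P) : powerset_space P := [set y | y <= x].

Definition Tailalg : Type := subalgebra_by (range principal_up).
Definition Taillat : Type := sublattice_by (range principal_up).

HB.instance Definition _ := Order.CTBDistrLattice.on Tailalg.
HB.instance Definition _ := Order.TBDistrLattice.on Taillat.

(* The closure is taken in powerset_space P; this type carries the subspace
   topology and the inclusion order. *)
Definition down_closure : Type := set_type (closure (range principal_down)).

HB.instance Definition _ := SubChoice.on down_closure.
HB.instance Definition _ := Topological.on down_closure.
HB.instance Definition _ :=
  [SubChoice_isSubPOrder of down_closure by <: with set_display].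

End Poset.

(* Main.v *)
(* A point X of the closure of down(P) defines a filter on the subsets of P:
   A belongs to it when A contains every z whose down-set is close enough to X.
   This filter decides each principal up-set, hence each member of Tailalg(P),
   so its trace on Tailalg(P) or Taillat(P) is prime; and X is recovered as
   {x | the trace contains up(x)}.  Conversely, for a prime filter F and
   X = {x | F contains up(x)}, if up(x) is in F for x in a finite set s, not in
   F for x in a finite set t, and a is in F but b is not, then the meet of a
   and the up(x) for x in s is not below the join of b and the up(x) for x in
   t.  A witness z of this failure puts X in the closure (a = top, b = bottom)
   and shows that the trace attached to X is F. *)

Require Import Defs.
From mathcomp Require Import all_boot all_order.
From mathcomp Require Import all_classical.
From mathcomp Require Import finmap topology.

Set Implicit Arguments.
Unset Strict Implicit.
Unset Printing Implicit Defensive.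

Import Order.Theory.

Local Open Scope order_scope.
Local Open Scope classical_set_scope.

(** * Ultrafilters and prime filters of a Boolean algebra *)

Lemma ultrafilter_prime (d : Order.disp_t) (B : ctbDistrLatticeType d)
    (U : set B) : boolean_ultrafilter U <-> prime_filter U.
Proof.
split=> [[pU maxU]|[pU primeU]]; split=> //; case: (pU) => [U1 U0 Ule UI].
  move=> a b Uab; have [Ua|nUa] := pselect (U a); first by left.
  (* [V] is the filter generated by [U] and [a]. If it were proper, maximality would put [a] in [U];
     hence [u] meets [a] in bottom for some [u] in [U], and the meet of [u] with the join of [a] and
     [b] lies below [b]. *)
  right; pose V := [set c | exists2 u, U u & (u `&` a)%O <= c].
  have VU : U `<=` V by move=> u Uu; exists u => //; rewrite leIl.
  have Va : V a by exists \top; rewrite ?meet1x.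
  have [[u Uu ua0]|nV0] := pselect (V \bot); last first.
    suff pV : proper_lattice_filter V by case: nUa; rewrite -(maxU V pV VU).
    split=> //; first exact: VU.
      by move=> c e ce [u Uu uc]; exists u => //; exact: le_trans ce.
    move=> c e [u Uu uc] [w Uw we]; exists (u `&` w)%O; first exact: UI.
    rewrite lexI; apply/andP; split.
      by apply: le_trans uc; rewrite leI2 ?leIl.
    by apply: le_trans we; rewrite leI2 ?leIr.
  apply: Ule (UI _ _ Uu Uab); move: ua0; rewrite lex0 => /eqP ua0.
  by rewrite meetUr ua0 join0x leIr.
move=> V [V1 V0 Vle VI] UV; apply/seteqP; split=> // a Va.
have /primeU[//|Uca] : U (a `|` ~` a)%O by rewrite joinxC.
by case: V0; rewrite -(meetxC a); apply: VI => //; exact: UV.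
Qed.

(** * Continuity criteria for maps into the power set, subspaces and spectra *)

Lemma continuous_powerset (Z : topologicalType) (T : choiceType)
    (f : Z -> powerset_space T) :
  (forall x, open [set z | f z x]) -> (forall x, open [set z | ~ f z x]) ->
  continuous f.
Proof.
move=> f_in f_out z N /(proj2 (cylinder_basis T))[C [[F [G [+ + ->]]]]].
move=> /finite_seqP[s ->] /finite_seqP[t ->] [sf tf] CN.
rewrite nbhs_simpl; suff : \forall y \near z, cylinder [set` s] [set` t] (f y).
  by apply: filterS => y /CN.
have ins (x : T) : x \in s -> \forall y \near z, f y x.
  by move=> /sf fzx; apply: open_nbhs_nbhs; split; first exact: f_in.
have outt (x : T) : x \in t -> \forall y \near z, ~ f y x.
  move=> xt; apply: open_nbhs_nbhs; split=> [|fzx]; first exact: f_out.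
  by rewrite -[False]/(set0 x) -tf.
(* A cylinder imposes finitely many membership conditions, and finitely many neighbourhoods of [z]
   have a common refinement. *)
have near_all (r : seq T) (Q : T -> Z -> Prop) :
    (forall x, x \in r -> \forall y \near z, Q x y) ->
    \forall y \near z, forall x, x \in r -> Q x y.
  elim: r => [_|x r IH near_r]; first exact: nearW.
  have near_x := near_r x (mem_head x r).
  have {}IH := IH (fun y yr => near_r y (@mem_behead _ (x :: r) y yr)).
  apply: filterS2 near_x IH => y Qx Qr x'; rewrite inE => /orP[/eqP->//|].
  exact: Qr.
apply: filterS2 (near_all s _ ins) (near_all t _ outt) => y ys yt; split.
  by move=> x /ys.
by rewrite -subset0 => x [/= /yt].
Qed.

Lemma continuous_set_type (Z X : topologicalType) (A : set X) (f : Z -> A) :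
  continuous (fun z => \val (f z)) -> continuous f.
Proof.
move=> cf z N [_ [[O oO <-] Oz] ON].
have /cf : nbhs (\val (f z) : X) O by apply: open_nbhs_nbhs; split.
by apply: (@filterS _ (nbhs z)) => y; exact: ON.
Qed.

Section Stone_topology.
Context (d : Order.disp_t) (B : ctbDistrLatticeType d).

Lemma open_stone_open (a : B) : open (stone_open a).
Proof.
exists [set stone_open a]; first by move=> _ ->; exists a.
by rewrite bigcup_set1.
Qed.

Lemma stone_continuous (Z : topologicalType) (f : Z -> stone_space B) :
  (forall a, open [set z | \val (f z) a]) -> continuous f.
Proof.
move=> fo; apply/continuousP => _ [D DB <-].
rewrite preimage_bigcup; apply: bigcup_open => O /DB[a _ <-].
exact: fo.
Qed.

End Stone_topology.

Section Priestley_topology.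
Context (d : Order.disp_t) (L : tbDistrLatticeType d).

Lemma open_priestley_subbase (O : set (priestley_space L)) :
  (range (@priestley_in _ L) `|` range (@priestley_out _ L)) O -> open O.
Proof.
move=> sO; exists [set O]; last by rewrite bigcup_set1.
move=> _ ->; exists [fset O]%fset.
  by move=> O'; rewrite inE => /eqP ->; apply/mem_set.
by rewrite set_fset1 bigcap_set1.
Qed.

Lemma priestley_continuous (Z : topologicalType) (f : Z -> priestley_space L) :
  (forall a, open [set z | \val (f z) a]) ->
  (forall a, open [set z | ~ \val (f z) a]) -> continuous f.
Proof.
move=> fi fo; apply/continuousP => _ [D DB <-].
rewrite preimage_bigcup; apply: bigcup_open => _ /DB[K Ksub <-].
rewrite preimage_bigcap bigcap_fset big_seq; apply: big_ind => [||O OK].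
- exact: openT.
- exact: openI.
by have /set_mem[[a _ <-]|[a _ <-]] := Ksub _ OK; [exact: fi|exact: fo].
Qed.

End Priestley_topology.

Lemma down_closureP (d : Order.disp_t) (P : porderType d)
    (X : down_closure P) : closure (range (@principal_down _ P)) (\val X).
Proof. exact: set_mem (valP X). Qed.

Arguments down_closureP {d P} X.

(** * The filter on subsets of P attached to a point of the power set *)

Section Trace.
Context (d : Order.disp_t) (P : porderType d).
Implicit Types (X : powerset_space P) (A : set P).

(** This is the preimage under [principal_down] of the neighbourhood filter of [X]; it is proper
    exactly when [X] lies in the closure of down(P). *)
Definition trace_filter X : set (set P) :=
  [set A | \forall Y \near X, forall z, Y = principal_down z -> A z].

Arguments trace_filter : simpl never.

Lemma trace_filterT X : trace_filter X setT.
Proof. exact: (@nearW _ (nbhs X)). Qed.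

Lemma trace_filterI X A A' :
  trace_filter X A -> trace_filter X A' -> trace_filter X (A `&` A').
Proof.
apply: (@filterS2 _ (nbhs X)) => Y YA YA' z Yz.
by split; [exact: YA|exact: YA'].
Qed.

Lemma trace_filterS X A A' :
  A `<=` A' -> trace_filter X A -> trace_filter X A'.
Proof. by move=> AA'; apply: (@filterS _ (nbhs X)) => Y YA z /YA/AA'. Qed.

(** The points having a given set as a neighbourhood form its interior. Continuity of the maps into
    both spectra rests on this. *)
Lemma open_trace_filter A : open [set X | trace_filter X A].
Proof. by rewrite openE => X /nbhs_interior. Qed.

Lemma trace_filter0 X : closure (range (@principal_down _ P)) X ->
  ~ trace_filter X set0.
Proof. by move=> cX /cX[_ [[z _ <-]]] /(_ z erefl). Qed.

(** Some cylinder around [X] lies inside the neighbourhood, and [principal_down z] belongs to it as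
    soon as [z] satisfies finitely many order conditions. This is the form that [prime_witness] can
    contradict. *)
Lemma trace_filterP X A : trace_filter X A ->
  exists s t : seq P, [/\ forall x, x \in s -> X x,
    forall x, x \in t -> ~ X x &
    forall z, (forall x, x \in s -> x <= z) ->
              (forall x, x \in t -> ~ x <= z) -> A z].
Proof.
move=> /(proj2 (cylinder_basis P))[_ [[F [G [+ + ->]]]]].
move=> /finite_seqP[s ->] /finite_seqP[t ->] [sX tX] CA.
exists s, t; split=> [x /sX //|x xt Xx|z sz tz].
  by rewrite -[False]/(set0 x) -tX.
apply: (CA (principal_down z)) => //; split=> [x /sz//|].
by rewrite -subset0 => x [/= /tz].
Qed.

Lemma trace_filter_up X x : X x -> trace_filter X (principal_up x).
Proof.
move=> Xx; have : \forall Y \near X, `[< Y x >] = true.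
  apply: open_nbhs_nbhs; split; first exact: charfun_coord_open.
  exact/asboolP.
by apply: filterS => Y /asboolP Yx z Yz; rewrite /principal_up /= Yz in Yx *.
Qed.

Lemma trace_filter_upC X x : ~ X x -> trace_filter X (~` principal_up x).
Proof.
move=> Xx; have : \forall Y \near X, `[< Y x >] = false.
  apply: open_nbhs_nbhs; split; first exact: charfun_coord_open.
  exact/asboolP.
by apply: filterS => Y /asboolP Yx z Yz xz; apply: Yx; rewrite Yz.
Qed.

Definition tail_sets : set (set P) :=
  smallest (@boolean_subalgebra P) (range (@principal_up _ P)).

Lemma trace_filter_decides X A : tail_sets A ->
  trace_filter X A \/ trace_filter X (~` A).
Proof.
(* The decided sets form a Boolean subalgebra containing every principal up-set, hence contain the
   generated one. *)
move=> /(_ [set A | trace_filter X A \/ trace_filter X (~` A)]); apply; split.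
  split; first split.
  - by right; rewrite setC0; exact: trace_filterT.
  - by left; exact: trace_filterT.
  - move=> B C [XB|XB] [XC|XC]; rewrite /= setCU; [left|left|left|right].
    + by apply: trace_filterS XB => z; left.
    + by apply: trace_filterS XB => z; left.
    + by apply: trace_filterS XC => z; right.
    + exact: trace_filterI.
  - move=> B C [XB|XB] [XC|XC]; rewrite /= setCI; [left|right|right|right].
    + exact: trace_filterI.
    + by apply: trace_filterS XC => z; right.
    + by apply: trace_filterS XB => z; left.
    + by apply: trace_filterS XB => z; left.
  by move=> B [XB|XB]; [right; rewrite setCK|left].
move=> _ [x _ <-]; have [Xx|Xx] := pselect (X x).
  by left; exact: trace_filter_up.
by right; exact: trace_filter_upC.
Qed.

Lemma trace_filterU X A A' : tail_sets A -> trace_filter X (A `|` A') ->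
  trace_filter X A \/ trace_filter X A'.
Proof.
move=> tA XAA'; have [XA|XA] := trace_filter_decides X tA; first by left.
by right; apply: trace_filterS (trace_filterI XA XAA') => z [nAz []].
Qed.

Section Closed.
Context X (cX : closure (range (@principal_down _ P)) X).

Lemma trace_filterC A : trace_filter X A -> ~ trace_filter X (~` A).
Proof.
move=> XA XC; apply: (trace_filter0 cX).
by rewrite -(setICr A); exact: trace_filterI.
Qed.

Lemma trace_filterCE A : tail_sets A ->
  trace_filter X (~` A) <-> ~ trace_filter X A.
Proof.
move=> tA; split=> [XC XA|nXA]; first exact: trace_filterC XC.
by case: (trace_filter_decides X tA).
Qed.

Lemma trace_filter_upE x : trace_filter X (principal_up x) <-> X x.
Proof.
split=> [Xx|]; last exact: trace_filter_up.
by apply: contrapT => /trace_filter_upC; exact: trace_filterC.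
Qed.

End Closed.

End Trace.

(* Satisfied by Tailalg(P) and by Taillat(P), which share the two maps between
   the closure of down(P) and the prime filters. *)
Record tail_embedding (d d' : Order.disp_t) (P : porderType d)
    (L : tbDistrLatticeType d') (v : L -> set P) (up : P -> L) : Prop := {
  embed_bot : v \bot = set0;
  embed_top : v \top = setT;
  embed_join : forall a b, v (a `|` b)%O = v a `|` v b;
  embed_meet : forall a b, v (a `&` b)%O = v a `&` v b;
  embed_le : forall a b, a <= b <-> v a `<=` v b;
  embed_up : forall x, v (up x) = principal_up x;
  embed_tail : forall a, tail_sets (v a)
}.

(** * The two maps between the closure of down(P) and the prime filters *)

Section Spectrum.
Context (d d' : Order.disp_t) (P : porderType d) (L : tbDistrLatticeType d').
Context (v : L -> set P) (up : P -> L) (vP : tail_embedding v up).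

Definition trace_prime (X : powerset_space P) : set L :=
  [set a | trace_filter X (v a)].

Definition prime_trace (F : set L) : powerset_space P := [set x | F (up x)].

Lemma trace_prime_prime X : closure (range (@principal_down _ P)) X ->
  prime_filter (trace_prime X).
Proof.
move=> cX; split; first split; rewrite /trace_prime /=.
- by rewrite (embed_top vP); exact: trace_filterT.
- by rewrite (embed_bot vP); exact: trace_filter0.
- by move=> a b /(embed_le vP); exact: trace_filterS.
- by move=> a b; rewrite (embed_meet vP); exact: trace_filterI.
move=> a b; rewrite /= (embed_join vP); apply: trace_filterU.
exact: embed_tail vP a.
Qed.

(** The conditions from [s] are absorbed into [a] by meets, those from [t] into [b] by joins;
    primeness keeps the enlarged [b] outside [F]. Once both lists are empty, [a] is not below [b]
    because [F] is upward closed, and [v] reflects the order, so a point separates them. *)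
Lemma prime_witness (F : set L) (s t : seq P) (a b : L) : prime_filter F ->
  (forall x, x \in s -> F (up x)) -> (forall x, x \in t -> ~ F (up x)) ->
  F a -> ~ F b ->
  exists z, [/\ forall x, x \in s -> x <= z, forall x, x \in t -> ~ x <= z,
                v a z & ~ v b z].
Proof.
move=> [[F1 F0 Fle FI] FU].
elim: s a => [|x s IH] a Fs Ft Fa Fb; last first.
  have [||z [sz tz vaz vbz]] := IH (up x `&` a)%O _ Ft _ Fb.
  - by move=> y ys; apply: Fs; rewrite inE ys orbT.
  - by apply: FI => //; apply: Fs; rewrite mem_head.
  move: vaz; rewrite (embed_meet vP) (embed_up vP) => -[xz vaz].
  exists z; split=> //.
  by move=> y; rewrite inE => /orP[/eqP->//|]; exact: sz.
elim: t b Ft Fb {Fs} => [|x t IH] b Ft Fb.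
  have : ~ a <= b by move=> /Fle/(_ Fa).
  move=> /(embed_le vP)/existsNP[z /not_implyP[vaz vbz]].
  by exists z; split.
have [|/FU[//|]|z [_ tz vaz]] := IH (b `|` up x)%O.
- by move=> y yt; apply: Ft; rewrite inE yt orbT.
- by apply: Ft; rewrite mem_head.
rewrite (embed_join vP) (embed_up vP) => /not_orP[vbz xz]; exists z; split=> //.
by move=> y; rewrite inE => /orP[/eqP->//|]; exact: tz.
Qed.

Lemma prime_trace_closure F : prime_filter F ->
  closure (range (@principal_down _ P)) (prime_trace F).
Proof.
move=> pF N /(proj2 (cylinder_basis P))[_ [[S [T [+ + ->]]]]].
move=> /finite_seqP[s ->] /finite_seqP[t ->] [sF tF] CN.
have [F1 F0 _ _] := pF.1.
have [||z [sz tz _ _]] := prime_witness pF (s := s) (t := t) _ _ F1 F0.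
- by move=> x /sF.
- by move=> x xt Fx; rewrite -[False]/(set0 x) -tF.
exists (principal_down z); split; first by exists z.
by apply: CN; split=> [x /sz//|]; rewrite -subset0 => x [/= /tz].
Qed.

Lemma prime_traceK F : prime_filter F -> trace_prime (prime_trace F) = F.
Proof.
move=> pF; have [F1 F0 Fle FI] := pF.1; apply/seteqP; split=> a.
  move=> /trace_filterP[s [t [sF tF stA]]]; apply: contrapT => nFa.
  (* The witness for top in [F] and [a] outside [F] meets the conditions of [s] and [t], yet misses
     [v a]. *)
  by have [z [sz tz _]] := prime_witness pF sF tF F1 nFa; apply; exact: stA.
move=> Fa; have [//|] := trace_filter_decides (prime_trace F) (embed_tail vP a).
move=> /trace_filterP[s [t [sF tF stA]]].
(* Here the witness lies in [v a], whereas [s] and [t] force it into the complement. *)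
by have [z [sz tz va _]] := prime_witness pF sF tF Fa F0; case: (stA z).
Qed.

Lemma trace_primeK X : closure (range (@principal_down _ P)) X ->
  prime_trace (trace_prime X) = X.
Proof.
move=> cX; apply/seteqP; split=> x;
  rewrite /prime_trace /trace_prime /= (embed_up vP);
  by move/(trace_filter_upE cX).
Qed.

Lemma open_trace_prime a :
  open [set X : down_closure P | trace_prime (\val X) a].
Proof.
by exists [set X | trace_filter X (v a)]; first exact: open_trace_filter.
Qed.

(** On the closure of down(P), omitting [v a] amounts to containing its complement, which is an open
    condition. *)
Lemma open_trace_primeC a :
  open [set X : down_closure P | ~ trace_prime (\val X) a].
Proof.
exists [set X | trace_filter X (~` v a)]; first exact: open_trace_filter.
by apply/seteqP; split=> X;
  move=> /(trace_filterCE (down_closureP X) (embed_tail vP a)).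
Qed.

End Spectrum.

(** * The Stone space of Tailalg(P) *)

Section Stone_homeomorphism.
Context (d : Order.disp_t) (P : porderType d).
Local Notation B := (Tailalg P).

Let tailalg_val (a : B) : set P := \val a.

Let principal_up_tail (x : P) :
  principal_up x \in
    smallest (@boolean_subalgebra P) (range (@principal_up _ P)).
Proof. by apply/mem_set => S [_]; apply; exists x. Qed.

Let tailalg_up (x : P) : B := exist _ (principal_up x) (principal_up_tail x).

Let tailalg_embedding : tail_embedding tailalg_val tailalg_up.
Proof.
split=> // [a b|a]; last exact: set_mem (valP a).
by rewrite -[a <= b]/(\val a <= \val b) subsetEset.
Qed.

Lemma homeomorphic_stone : homeomorphic (down_closure P) (stone_space B).
Proof.
have fP (X : down_closure P) :
    trace_prime tailalg_val (\val X) \in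
      [set U : set B | boolean_ultrafilter U].
  apply/mem_set/ultrafilter_prime.
  exact: (trace_prime_prime tailalg_embedding (down_closureP X)).
have pU (U : stone_space B) : prime_filter (\val U).
  exact/ultrafilter_prime/(set_mem (valP U)).
have gP (U : stone_space B) :
    prime_trace tailalg_up (\val U) \in closure (range (@principal_down _ P)).
  exact/mem_set/(prime_trace_closure tailalg_embedding (pU U)).
pose f (X : down_closure P) : stone_space B :=
  exist _ (trace_prime tailalg_val (\val X)) (fP X).
pose g (U : stone_space B) : down_closure P :=
  exist _ (prime_trace tailalg_up (\val U)) (gP U).
exists f; split.
  by apply: stone_continuous => a; exact: open_trace_prime.
exists g; split.
- move=> X; apply: val_inj.
  exact: (trace_primeK tailalg_embedding (down_closureP X)).
- by move=> U; apply: val_inj; exact: (prime_traceK tailalg_embedding (pU U)).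
apply: continuous_set_type; apply: continuous_powerset => x.
  exact: (open_stone_open (tailalg_up x)).
(* Non-membership is open in the Stone topology because an ultrafilter omits an element exactly when
   it contains the complement. *)
suff -> : [set U | ~ \val (g U) x] = stone_open (~` tailalg_up x)%O.
  exact: open_stone_open.
have Ucompl (U : stone_space B) (a : B) : \val U (~` a)%O <-> ~ \val U a.
  have [[U1 U0 _ UI] UU] := pU U; split=> [Uca Ua|nUa].
    by apply: U0; rewrite -(meetxC a); exact: UI.
  by have /UU[] : \val U (a `|` ~` a)%O by rewrite joinxC.
by apply/seteqP; split=> U /Ucompl.
Qed.

End Stone_homeomorphism.

(** * The Priestley space of Taillat(P), with its order *)

Section Priestley_isomorphism.
Context (d : Order.disp_t) (P : porderType d).
Local Notation L := (Taillat P).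

Let taillat_val (a : L) : set P := \val a.

Let principal_up_tail (x : P) :
  principal_up x \in
    smallest (@bounded_sublattice P) (range (@principal_up _ P)).
Proof. by apply/mem_set => S [_]; apply; exists x. Qed.

Let taillat_up (x : P) : L := exist _ (principal_up x) (principal_up_tail x).

Let taillat_embedding : tail_embedding taillat_val taillat_up.
Proof.
split=> // [a b|a]; first by rewrite -[a <= b]/(\val a <= \val b) subsetEset.
(* Every Boolean subalgebra is a bounded sublattice, so the generated sublattice lies inside the
   generated subalgebra. *)
by move=> S [[S_lat _] S_up]; apply: (set_mem (valP a)); split.
Qed.

Let trace_filter_mono (X Y : powerset_space P) (a : L) :
  closure (range (@principal_down _ P)) X -> X `<=` Y ->
  trace_filter X (\val a) -> trace_filter Y (\val a).
Proof.
move=> cX XY.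
(* Monotonicity in [X] holds on principal up-sets and survives unions and intersections. Carrying
   [tail_sets A] along allows a union to be split by [trace_filterU]. *)
have /(_ [set A | tail_sets A /\ (trace_filter X A -> trace_filter Y A)]) :=
  set_mem (valP a).
have [[tail0 tailT tailU tailI] _] := alg_closed (range (@principal_up _ P)).
case=> //; split; first split=> //.
- by split=> // /(trace_filter0 cX).
- by split=> // _; exact: trace_filterT.
- move=> A A' [tA XYA] [tA' XYA']; split; first exact: tailU.
  move=> /(trace_filterU tA)[/XYA|/XYA'].
    by apply: trace_filterS => z; left.
  by apply: trace_filterS => z; right.
- move=> A A' [tA XYA] [tA' XYA']; split; first exact: tailI.
  move=> XAA'; apply: trace_filterI; [apply: XYA|apply: XYA'];
    by apply: trace_filterS XAA' => z [].
move=> _ [x _ <-]; split; first by move=> S [_]; apply; exists x.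
by move=> /(trace_filter_upE cX)/XY; exact: trace_filter_up.
Qed.

Lemma order_homeomorphic_priestley :
  order_homeomorphic (down_closure P) (priestley_space L).
Proof.
have fP (X : down_closure P) :
    trace_prime taillat_val (\val X) \in [set F : set L | prime_filter F].
  apply/mem_set.
  exact: (trace_prime_prime taillat_embedding (down_closureP X)).
have pF (F : priestley_space L) : prime_filter (\val F).
  exact: set_mem (valP F).
have gP (F : priestley_space L) :
    prime_trace taillat_up (\val F) \in closure (range (@principal_down _ P)).
  exact/mem_set/(prime_trace_closure taillat_embedding (pF F)).
pose f (X : down_closure P) : priestley_space L :=
  exist _ (trace_prime taillat_val (\val X)) (fP X).
pose g (F : priestley_space L) : down_closure P :=
  exist _ (prime_trace taillat_up (\val F)) (gP F).
exists f; split; first split.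
- apply: priestley_continuous => a; first exact: open_trace_prime.
  exact: (open_trace_primeC taillat_embedding).
- exists g; split.
  + move=> X; apply: val_inj.
    exact: (trace_primeK taillat_embedding (down_closureP X)).
  + by move=> F; apply: val_inj; exact: (prime_traceK taillat_embedding (pF F)).
  apply: continuous_set_type; apply: continuous_powerset => x.
    by apply: open_priestley_subbase; left; exists (taillat_up x).
  by apply: open_priestley_subbase; right; exists (taillat_up x).
move=> X Y; rewrite -[f X <= f Y]/(\val (f X) <= \val (f Y)).
rewrite -[X <= Y]/((\val X : set P) <= \val Y).
apply/idP/idP; rewrite !subsetEset => XY.
  (* Inclusion of the traces is tested on the single element [taillat_up x]. *)
  move=> x Xx; apply/(trace_filter_upE (down_closureP Y)).
  by apply: (XY (taillat_up x)); exact: trace_filter_up.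
by move=> a; apply: trace_filter_mono XY; exact: down_closureP.
Qed.

End Priestley_isomorphism.

Theorem theorem3 (d : Order.disp_t) (P : porderType d) :
  homeomorphic (down_closure P) (stone_space (Tailalg P)) /\
  order_homeomorphic (down_closure P) (priestley_space (Taillat P)).
Proof.
by split; [exact: homeomorphic_stone|exact: order_homeomorphic_priestley].
Qed.
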